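(* Let $A,B\in\Gamma$ be formal power series, and let $\beta_A,\beta_B$ be some Böttcher functions of $A$ and $B$ respectively. Then the equation $X\circ A^{\circ l}=Y\circ B^{\circ s}$ has a solution in nonzero $X,Y\in zk[[z]]$ for all $s,l\ge1$ if and only if $\beta_A=\beta_B\circ cz$ for some $c\in k^*$.
   Context: $k$ is an algebraically closed field of characteristic zero and $k[[z]]$ is the ring of formal power series over $k$; $zk[[z]]$ is the set of series with zero constant term. The order of a nonzero series is the smallest exponent with nonzero coefficient. $k_1[[z]]$ is the group under composition $\circ$ of series of order exactly $1$, and $\Gamma$ is the semigroup under $\circ$ of (nonzero) series of order at least $2$. $A^{\circ l}$ denotes the $l$-th iterate of $A$ under composition. A Böttcher function of $A\in\Gamma$ with $\operatorname{ord}A=n$ is an element $\beta_A\in k_1[[z]]$ with $\beta_A^{-1}\circ A\circ\beta_A=z^n$; such functions always exist and are unique up to $\beta_A\mapsto\beta_A\circ\varepsilon z$, $\varepsilon^{n-1}=1$. *)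

(* Defs.v *)
From mathcomp Require Import all_boot all_order all_algebra.

Set Implicit Arguments.
Unset Strict Implicit.
Unset Printing Implicit Defensive.

Import GRing.Theory.
Local Open Scope ring_scope.

(* A series is its sequence of coefficients: [A n] is the coefficient of z^n. *)
Definition fps (k : nzRingType) := nat -> k.

Section FormalPowerSeries.

Variable k : fieldType.
Implicit Types A B X Y beta gamma : fps k.

Definition fps_zero : fps k := fun=> 0.

(* The series c z^n. *)
Definition fps_monomial (c : k) (n : nat) : fps k :=
  fun i => if i == n then c else 0.

Definition fps_id : fps k := fps_monomial 1 1.

Definition fps_mul A B : fps k :=
  fun n => \sum_(i < n.+1) A i * B (n - i)%N.

Definition fps_exp A (i : nat) : fps k :=
  iter i (fps_mul A) (fps_monomial 1 0).

(* A o B = \sum_i A_i B^i.  This is meaningful when B has zero constant term;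
   then z^i divides B^i, so only the indices i <= n contribute to the
   coefficient of z^n. *)
Definition fps_comp A B : fps k :=
  fun n => \sum_(i < n.+1) A i * fps_exp B i n.

Definition fps_iter_comp (l : nat) A : fps k := iter l (fps_comp A) fps_id.

Definition has_order A (n : nat) : Prop :=
  A n != 0 /\ forall i, (i < n)%N -> A i = 0.

(* The group k_1[[z]]. *)
Definition in_k1 A : Prop := has_order A 1.

(* The semigroup Gamma. *)
Definition in_Gamma A : Prop := exists2 n, (2 <= n)%N & has_order A n.

(* gamma is the inverse of beta in the group k_1[[z]]. *)
Definition comp_inverse beta gamma : Prop :=
  [/\ in_k1 gamma, fps_comp beta gamma = fps_id & fps_comp gamma beta = fps_id].

(* beta^{-1} o A o beta = z^n with n = ord A and beta in k_1[[z]]. *)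
Definition Bottcher_function A beta : Prop :=
  in_k1 beta /\
  exists n gamma,
    [/\ has_order A n, comp_inverse beta gamma &
        fps_comp (fps_comp gamma A) beta = fps_monomial 1 n].

End FormalPowerSeries.

Arguments fps_zero {k}.
Arguments fps_id {k}.

(* Main.v *)
(** Put mu = beta_A^{-1} o beta_B.  Composing with beta_B turns a solution of
    X o A^l = Y o B^s into X' o z^N o mu = Y' o z^M with N = (ord A)^l and
    M = (ord B)^s.  If mu = c z + a z^(r+1) + ... with a <> 0 and N, M > r, then
    the left-hand side has order N d, d = ord X', and in characteristic zero its
    coefficient of z^(N d + r) is nonzero.  Both exponents are multiples of M
    because of the right-hand side, so M divides r < M, which is absurd; hence
    mu = c z.  Conversely, if mu is linear, suitable monomials X' and Y' solve
    the equation. *)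
Require Import Defs.
From Stdlib Require Import FunctionalExtensionality.
From mathcomp Require Import all_boot all_order all_algebra ring.
Import GRing.Theory.
Local Open Scope ring_scope.

(** * Low coefficients of powers of polynomials *)

Lemma coef_exp_lt (R : nzRingType) (q : {poly R}) (i j : nat) :
  q`_0 = 0 -> (i < j)%N -> (q ^+ j)`_i = 0.
Proof.
move=> q0; elim: j i => // j IHj i ltij.
rewrite exprS coefM big1 // => -[[|l] ltl] _ /=; first by rewrite q0 mul0r.
by rewrite IHj ?mulr0 // ltn_subLR // addSn (leq_trans ltij) // ltnS leq_addl.
Qed.

(** A first-order expansion in 'X^r: all later terms are absorbed in [v], of which only the constant
    term will matter. For K = 0 the multiple [*+ K] is zero, so the truncated [K.-1] is harmless. *)
Lemma exp_first_order (R : comNzRingType) (c : R) (w : {poly R}) (r K : nat) :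
  (0 < r)%N ->
  exists2 v : {poly R}, v`_0 = c ^+ K.-1 * w`_0 *+ K &
    (c%:P + 'X^r * w) ^+ K = (c ^+ K)%:P + 'X^r * v.
Proof.
move=> r_gt0; elim: K => [|K [v v0 IHK]].
  by exists 0; rewrite ?coef0 ?mulr0n // mulr0 addr0 !expr0.
exists (c%:P * v + (c ^+ K)%:P * w + 'X^r * (w * v)).
  rewrite !coefD !coefCM coefXnM r_gt0 addr0 v0 /= mulrSr; congr (_ + _).
  by case: K {IHK v0} => [|K]; rewrite ?mulr0n ?mulr0 // mulrnAr mulrA -exprS.
rewrite exprS IHK exprS polyCM; ring.
Qed.

(** * Laws of composition, obtained from polynomial truncations *)

Section FormalPowerSeriesTheory.

Variable k : fieldType.
Implicit Types (A B C X Y beta gamma mu : fps k) (p q : {poly k}).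

(** Congruence modulo z^n. Identities between series are transferred from polynomials, whose
    composition is already known to be associative. *)
Definition approx (n : nat) A p := forall i, (i < n)%N -> A i = p`_i.

Lemma approx_poly n A : approx n A (\poly_(i < n) A i).
Proof. by move=> i ltin; rewrite coef_poly ltin. Qed.

Lemma fps_eq_approx A B :
  (forall n, exists2 p, approx n A p & approx n B p) -> A = B.
Proof.
move=> eqAB; apply: functional_extensionality => i.
by have [p Ap Bp] := eqAB i.+1; rewrite Ap ?Bp.
Qed.

Lemma approx_monomial n (c : k) m : approx n (fps_monomial c m) (c *: 'X^m).
Proof.
by move=> i _; rewrite /fps_monomial coefZ coefXn; case: eqP; rewrite ?mulr1 ?mulr0.
Qed.

Lemma approx_mul n A B p q :
  approx n A p -> approx n B q -> approx n (fps_mul A B) (p * q).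
Proof.
move=> Ap Bq i ltin; rewrite coefM; apply: eq_bigr => -[j /= ltj] _.
rewrite Ap ?Bq //; first exact: leq_ltn_trans (leq_subr _ _) ltin.
exact: leq_trans ltj ltin.
Qed.

Lemma approx_exp n A p j : approx n A p -> approx n (fps_exp A j) (p ^+ j).
Proof.
move=> Ap; elim: j => [|j IHj].
  by rewrite expr0 -(expr0 'X) -['X ^+ 0]scale1r; apply: approx_monomial.
by rewrite exprS; apply: approx_mul.
Qed.

(** As q has no constant term, q^j has no term below degree j; so cutting the sum at the index [i],
    as [fps_comp] does, loses nothing. *)
Lemma approx_comp n A B p q :
  B 0%N = 0 -> approx n A p -> approx n B q ->
  approx n (fps_comp A B) (p \Po q).
Proof.
move=> B0 Ap Bq i ltin.
have q0 : q`_0 = 0 by rewrite -Bq ?B0 // (leq_ltn_trans _ ltin).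
transitivity (\sum_(j < i.+1) p`_j * (q ^+ j)`_i).
  apply: eq_bigr => -[j /= ltj] _.
  by rewrite Ap ?(approx_exp _ _ _ j Bq) // (leq_trans ltj).
rewrite coef_comp_poly -!(big_mkord xpredT (fun j => p`_j * (q ^+ j)`_i)).
(* The two sums differ only in their range: the surplus terms vanish through q^j if p is long, and
   through the coefficients of p if it is short. *)
have [le_ip|lt_pi] := leqP i.+1 (size p).
  rewrite (big_cat_nat _ le_ip) //= [X in _ = _ + X]big1_seq ?addr0 // => j.
  by rewrite mem_index_iota => /= /andP[ltij _]; rewrite coef_exp_lt ?mulr0.
rewrite (big_cat_nat _ (ltnW lt_pi)) //= [X in _ + X]big1_seq ?addr0 // => j.
by rewrite mem_index_iota => /= /andP[lepj _]; rewrite nth_default ?mul0r.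
Qed.

Lemma fps_comp_coef0 A B : fps_comp A B 0%N = A 0%N.
Proof. by rewrite /fps_comp big_ord1 /fps_exp /= /fps_monomial eqxx mulr1. Qed.

Lemma fps_compA A B C : B 0%N = 0 -> C 0%N = 0 ->
  fps_comp (fps_comp A B) C = fps_comp A (fps_comp B C).
Proof.
move=> B0 C0; apply: fps_eq_approx => n.
pose t (D : fps k) := \poly_(i < n) D i.
exists (t A \Po (t B \Po t C)).
  by rewrite comp_polyA; do !apply: approx_comp => //; apply: approx_poly.
apply: approx_comp; rewrite ?fps_comp_coef0 //; first exact: approx_poly.
by apply: approx_comp => //; apply: approx_poly.
Qed.

Lemma fps_comp_id A : fps_comp A fps_id = A.
Proof.
apply: fps_eq_approx => n; exists (\poly_(i < n) A i); last exact: approx_poly.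
rewrite -[X in approx _ _ X]comp_polyXr -['X]scale1r.
by apply: approx_comp; [|apply: approx_poly|apply: approx_monomial].
Qed.

Lemma fps_id_comp A : A 0%N = 0 -> fps_comp fps_id A = A.
Proof.
move=> A0; apply: fps_eq_approx => n.
exists (\poly_(i < n) A i); last exact: approx_poly.
rewrite -[X in approx _ _ X]comp_polyX -['X]scale1r.
by apply: approx_comp; [|apply: approx_monomial|apply: approx_poly].
Qed.

Lemma fps_zero_comp A : fps_comp fps_zero A = fps_zero.
Proof.
by apply: functional_extensionality => i; apply: big1 => j _; rewrite mul0r.
Qed.

Lemma fps_monomial_coef0 (c : k) n : (0 < n)%N -> fps_monomial c n 0%N = 0.
Proof. by case: n. Qed.

Lemma fps_monomial_comp (a b : k) m n : (0 < n)%N ->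
  fps_comp (fps_monomial a m) (fps_monomial b n) =
  fps_monomial (a * b ^+ m) (n * m).
Proof.
move=> n_gt0; apply: fps_eq_approx => N.
exists ((a *: 'X^m) \Po (b *: 'X^n)); last first.
  rewrite linearZ /= rmorphXn /= comp_polyX exprZn scalerA -exprM.
  exact: approx_monomial.
by apply: approx_comp; rewrite ?fps_monomial_coef0 //; apply: approx_monomial.
Qed.

Lemma fps_monomial1_comp m A : A 0%N = 0 ->
  fps_comp (fps_monomial 1 m) A = fps_exp A m.
Proof.
move=> A0; apply: fps_eq_approx => n.
exists ((\poly_(i < n) A i) ^+ m); last exact/approx_exp/approx_poly.
rewrite -(comp_Xn_poly _ m) -['X^m]scale1r.
by apply: approx_comp; [|apply: approx_monomial|apply: approx_poly].
Qed.

Lemma fps_expM A m n : fps_exp (fps_exp A m) n = fps_exp A (m * n).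
Proof.
apply: fps_eq_approx => N; exists ((\poly_(i < N) A i) ^+ (m * n)).
  by rewrite exprM; do 2!apply: approx_exp; apply: approx_poly.
exact/approx_exp/approx_poly.
Qed.

(** * Coefficients of powers and of composites with powers *)

Lemma fps_exp_coef_lt A i j : A 0%N = 0 -> (i < j)%N -> fps_exp A j i = 0.
Proof.
move=> A0 ltij; rewrite (approx_exp _ _ _ _ (approx_poly i.+1 A)) //.
by rewrite coef_exp_lt // coef_poly.
Qed.

(** With c = [mu 1], factor mu = z (c + z^r w), where w has constant term [mu r.+1]. Then mu^K = z^K
    (c + z^r w)^K, and the first-order expansion gives both coefficients. *)
Lemma fps_exp_coef_lead mu r K : mu 0%N = 0 -> (0 < r)%N ->
  (forall j, (1 < j <= r)%N -> mu j = 0) ->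
  fps_exp mu K K = mu 1%N ^+ K /\
  fps_exp mu K (K + r)%N = mu 1%N ^+ K.-1 * mu r.+1 *+ K.
Proof.
move=> mu0 r_gt0 mu_gap; pose n := (K + r).+2.
pose w := \poly_(j < n) mu (r + j).+1.
have mu_w : approx n mu ('X * ((mu 1%N)%:P + 'X^r * w)).
  case=> [|j] ltjn; first by rewrite coefXM.
  rewrite coefXM coefD coefC coefXnM coef_poly /=.
  case: ltnP => [lt_jr|le_rj].
    by case: j lt_jr {ltjn} => [|j] ltjr; rewrite addr0 // mu_gap.
  rewrite subnKC // (leq_ltn_trans (leq_subr _ _) (ltnW ltjn)).
  by rewrite gtn_eqF ?add0r // (leq_trans r_gt0).
have [v v0 vE] := exp_first_order _ (mu 1%N) w r K r_gt0.
have coefK i : (i <= r)%N ->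
    fps_exp mu K (K + i)%N = ((mu 1%N ^+ K)%:P + 'X^r * v)`_i.
  move=> le_ir; rewrite (approx_exp _ _ _ K mu_w); last first.
    by rewrite /n ltnS leqW // leq_add2l.
  by rewrite exprMn vE coefXnM ltnNge leq_addr /= addKn.
split.
  by rewrite -[X in _ _ X = _]addn0 coefK // coefD coefC coefXnM r_gt0 addr0.
rewrite coefK // coefD coefC coefXnM ltnn subnn gtn_eqF // add0r v0.
by rewrite coef_poly addn0.
Qed.

(** Terms of index i < d vanish through X; those with i > d involve mu^(N i), which starts no
    earlier than z^(N (d + 1)), beyond the exponent e. *)
Lemma fps_comp_exp_coef X mu d N e : mu 0%N = 0 ->
  (forall i, (i < d)%N -> X i = 0) -> (d <= e)%N -> (e < N * d.+1)%N ->
  fps_comp X (fps_exp mu N) e = X d * fps_exp mu (N * d) e.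
Proof.
move=> mu0 Xd le_de lt_e; rewrite /fps_comp.
rewrite (bigD1 (Ordinal (le_de : d < e.+1)%N)) //= fps_expM big1 ?addr0 //.
move=> i; rewrite -val_eqE /= neq_ltn => /orP[lt_id|lt_di].
  by rewrite Xd ?mul0r.
rewrite fps_expM fps_exp_coef_lt ?mulr0 // (leq_trans lt_e) // leq_mul2l lt_di.
by rewrite orbT.
Qed.

Lemma fps_comp_monomial_coef Y M e : (0 < M)%N -> ~~ (M %| e)%N ->
  fps_comp Y (fps_monomial 1 M) e = 0.
Proof.
move=> M_gt0 ndvd; apply: big1 => i _.
rewrite -fps_monomial1_comp ?fps_monomial_coef0 // fps_monomial_comp //.
rewrite /fps_monomial; case: eqP => [eE|]; last by rewrite mulr0.
by rewrite eE dvdn_mulr in ndvd.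
Qed.

(** One step towards the linearity of mu. The bound r < N keeps the exponent N d + r below N (d +
    1), where later terms of X can enter; r < M prevents M from dividing r. *)
Lemma fps_comp_power_linear mu X Y r N M :
  [pchar k] =i pred0 -> mu 0%N = 0 -> mu 1%N != 0 -> (0 < r)%N ->
  (forall j, (1 < j <= r)%N -> mu j = 0) ->
  X 0%N = 0 -> X <> fps_zero -> (r < N)%N -> (r < M)%N ->
  fps_comp X (fps_exp mu N) = fps_comp Y (fps_monomial 1 M) ->
  mu r.+1 = 0.
Proof.
move=> char_k mu0 mu1 r_gt0 mu_gap X0 Xn0 lt_rN lt_rM eqXY.
apply/eqP/negPn/negP => mur; apply: Xn0; apply: functional_extensionality.
move=> d; elim/ltn_ind: d => -[|d] IHd //; set d' := d.+1 in IHd *.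
(* By the induction hypothesis a nonzero [X d'] makes [d'] the order of X; this is to be refuted. *)
apply/eqP/negPn/negP => Xd.
have N_gt0 : (0 < N)%N by apply: leq_ltn_trans lt_rN.
have M_gt0 : (0 < M)%N by apply: leq_ltn_trans lt_rM.
have dvd_M e : (e <= r)%N -> fps_exp mu (N * d') (N * d' + e)%N != 0 ->
    (M %| N * d' + e)%N.
  move=> le_er nz; apply/negPn/negP => /(fps_comp_monomial_coef Y _ _ M_gt0).
  rewrite -eqXY (fps_comp_exp_coef _ _ d') //.
  - by move/eqP; rewrite mulf_eq0 (negPf Xd) (negPf nz).
  - by rewrite (leq_trans _ (leq_addr _ _)) // leq_pmull.
  - by rewrite mulnS addnC ltn_add2r (leq_ltn_trans le_er).
have [c0 cr] := fps_exp_coef_lead mu r (N * d') mu0 r_gt0 mu_gap.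
have dvd0 : (M %| N * d')%N.
  by rewrite -[X in (_ %| X)%N]addn0 dvd_M // addn0 c0 expf_neq0.
have := dvd_M r (leqnn r); rewrite cr dvdn_addr // => dvdr.
(* Characteristic zero enters here: the integer factor [N * d'] is nonzero in k. *)
suff /dvdr/(dvdn_leq r_gt0) : mu 1%N ^+ (N * d').-1 * mu r.+1 *+ (N * d') != 0.
  by rewrite leqNgt lt_rM.
rewrite -mulr_natr !mulf_neq0 ?expf_neq0 // (iffLR (pcharf0P k) char_k).
by rewrite muln_eq0 negb_or -lt0n N_gt0.
Qed.

Lemma fps_comp_coef1 A B : B 0%N = 0 -> fps_comp A B 1%N = A 1%N * B 1%N.
Proof.
move=> B0; rewrite /fps_comp big_ord_recl big_ord1 /= /fps_exp /=.
rewrite /fps_mul big_ord_recl big_ord1 /= /fps_monomial /=.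
by rewrite B0 !(mulr0, mul0r) mulr1 !add0r.
Qed.

(** * Iterates and their conjugation to powers of z *)

Lemma fps_iter_comp_coef0 l A : A 0%N = 0 -> fps_iter_comp l A 0%N = 0.
Proof. by case: l => [|l] A0; rewrite // /fps_iter_comp iterS fps_comp_coef0. Qed.

Lemma fps_iter_comp_semiconj A beta n l :
  A 0%N = 0 -> beta 0%N = 0 -> (0 < n)%N ->
  fps_comp A beta = fps_comp beta (fps_monomial 1 n) ->
  fps_comp (fps_iter_comp l A) beta = fps_comp beta (fps_monomial 1 (n ^ l)).
Proof.
move=> A0 beta0 n_gt0 conj; elim: l => [|l IHl].
  by rewrite fps_id_comp // fps_comp_id.
rewrite /fps_iter_comp iterS -/(fps_iter_comp l A).
have z0 m : fps_monomial (1 : k) (n ^ m) 0%N = 0.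
  by rewrite fps_monomial_coef0 // expn_gt0 n_gt0.
rewrite fps_compA ?fps_iter_comp_coef0 // IHl -fps_compA // conj.
rewrite fps_compA ?z0 ?fps_monomial_coef0 // fps_monomial_comp ?expn_gt0 ?n_gt0 //.
by rewrite expr1n mulr1 expnSr.
Qed.

Lemma in_Gamma_coef0 A : in_Gamma A -> A 0%N = 0.
Proof. by case=> n lt1n [_ ->] //; apply: ltnW. Qed.

(** The conjugation is rewritten as A o beta = beta o z^n, a form that passes to iterates. The bound
    on n comes from comparing it with the order given by [in_Gamma]. *)
Lemma Bottcher_functionP A beta : in_Gamma A -> Bottcher_function A beta ->
  exists n gamma,
    [/\ (1 < n)%N, comp_inverse beta gamma, beta 0%N = 0, gamma 0%N = 0 &
        forall l, fps_comp (fps_iter_comp l A) beta =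
                  fps_comp beta (fps_monomial 1 (n ^ l))].
Proof.
move=> A_Gamma [[_ beta_lt] [n [gamma [[An An_lt] betaK conj]]]].
have A0 := in_Gamma_coef0 A A_Gamma.
have [[_ gamma_lt] betaV gammaV] := betaK.
have [beta0 gamma0] : beta 0%N = 0 /\ gamma 0%N = 0.
  by rewrite beta_lt ?gamma_lt.
have lt1n : (1 < n)%N.
  case: A_Gamma => m lt1m [Am Am_lt]; rewrite (leq_trans lt1m) // leqNgt.
  by apply/negP => /Am_lt/eqP; rewrite (negPf An).
exists n, gamma; split=> // l; apply: fps_iter_comp_semiconj => //.
  exact: ltnW.
rewrite -conj -fps_compA ?fps_comp_coef0 // -fps_compA // betaV.
by rewrite fps_id_comp.
Qed.

End FormalPowerSeriesTheory.

Theorem theorem1p6 (k : closedFieldType) (char_k : [pchar k] =i pred0)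
    (A B beta_A beta_B : fps k)
    (A_Gamma : in_Gamma A) (B_Gamma : in_Gamma B)
    (beta_AP : Bottcher_function A beta_A)
    (beta_BP : Bottcher_function B beta_B) :
  (forall s l : nat, (1 <= s)%N -> (1 <= l)%N ->
     exists X Y : fps k,
       [/\ X 0%N = 0 /\ X <> fps_zero,
           Y 0%N = 0 /\ Y <> fps_zero &
           fps_comp X (fps_iter_comp l A) = fps_comp Y (fps_iter_comp s B)])
  <->
  (exists2 c : k, c != 0 & beta_A = fps_comp beta_B (fps_monomial c 1)).
Proof.
have [n [gamma_A [lt1n [[gA1 _] bgA gbA] bA0 gA0 iterA]]] :=
  Bottcher_functionP _ _ _ A_Gamma beta_AP.
have [m [gamma_B [lt1m [_ bgB gbB] bB0 gB0 iterB]]] :=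
  Bottcher_functionP _ _ _ B_Gamma beta_BP.
have A0 := in_Gamma_coef0 _ _ A_Gamma; have B0 := in_Gamma_coef0 _ _ B_Gamma.
have Al0 l := fps_iter_comp_coef0 _ l A A0.
have Bs0 s := fps_iter_comp_coef0 _ s B B0.
have z0 p l : (1 < p)%N -> fps_monomial (1 : k) (p ^ l) 0%N = 0.
  by move=> lt1p; rewrite fps_monomial_coef0 // expn_gt0 ltnW.
split=> [solvable|[c c_neq0 bAE] s l _ _].
  pose mu := fps_comp gamma_A beta_B.
  have mu0 : mu 0%N = 0 by rewrite /mu fps_comp_coef0.
  have mu1 : mu 1%N != 0.
    by rewrite /mu fps_comp_coef1 // mulf_neq0 //; case: beta_BP => -[].
  have bBE : beta_B = fps_comp beta_A mu.
    by rewrite /mu -fps_compA // bgA fps_id_comp.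
  have mu_linear r : (0 < r)%N -> mu r.+1 = 0.
    elim/ltn_ind: r => r IHr r_gt0.
    (* The iterates are chosen depending on r: since n, m > 1, both n^(r+1) and m^(r+1) exceed r. *)
    have [X [Y [[X0 Xn0] _ eqXY]]] := solvable r.+1 r.+1 isT isT.
    apply: (fps_comp_power_linear k mu (fps_comp X beta_A) (fps_comp Y beta_B)
             r (n ^ r.+1) (m ^ r.+1)) => //.
    - by case=> // j /andP[j_gt0 le_jr]; apply: IHr.
    - by rewrite fps_comp_coef0.
    (* Composing with [gamma_A] recovers X from X o beta_A. *)
    - move=> XbA0; apply: Xn0.
      by rewrite -[X]fps_comp_id -bgA -fps_compA // XbA0 fps_zero_comp.
    - by rewrite ltnW // ltn_expl.
    - by rewrite ltnW // ltn_expl.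
    (* Both sides become the given equation composed with beta_B = beta_A o mu on the right. *)
    rewrite -fps_monomial1_comp // [RHS]fps_compA ?z0 // -iterB -[RHS]fps_compA //.
    rewrite -eqXY [RHS]fps_compA // bBE -[X in _ = fps_comp _ X]fps_compA //.
    by rewrite iterA !fps_compA ?fps_comp_coef0 ?z0.
  have muE : mu = fps_monomial (mu 1%N) 1.
    apply: functional_extensionality => -[|[|r]] //.
    exact: mu_linear.
  exists (mu 1%N)^-1; first by rewrite invr_eq0.
  rewrite bBE fps_compA // muE fps_monomial_comp // expr1.
  by rewrite {2}/fps_monomial /= mulfV // fps_comp_id.
(* Conversely, inverting beta_A = beta_B o cz expresses [gamma_B] through [gamma_A]. *)
have gBE : gamma_B = fps_comp (fps_monomial c 1) gamma_A.
  have c0 : fps_monomial c 1 0%N = 0 by [].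
  rewrite -[LHS]fps_comp_id -bgA -fps_compA // bAE.
  by rewrite -(fps_compA k gamma_B) // gbB fps_id_comp.
have monomial_neq0 (D beta : fps k) (b : k) p : b != 0 ->
    fps_comp D beta = fps_monomial b p -> D <> fps_zero.
  move=> b_neq0 Dbeta D0; move: Dbeta; rewrite D0 fps_zero_comp.
  move/(congr1 (fun f : fps k => f p)); rewrite /fps_monomial eqxx => /esym/eqP.
  by rewrite (negPf b_neq0).
have iterAV : fps_comp gamma_A (fps_iter_comp l A) =
    fps_comp (fps_monomial 1 (n ^ l)) gamma_A.
  rewrite -[LHS]fps_comp_id -bgA [LHS]fps_compA ?fps_comp_coef0 // -(fps_compA k _ beta_A) //.
  by rewrite iterA -!fps_compA ?fps_comp_coef0 ?z0 // gbA fps_id_comp ?z0.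
have iterBV : fps_comp gamma_B (fps_iter_comp s B) =
    fps_comp (fps_monomial 1 (m ^ s)) gamma_B.
  rewrite -[LHS]fps_comp_id -bgB [LHS]fps_compA ?fps_comp_coef0 // -(fps_compA k _ beta_B) //.
  by rewrite iterB -!fps_compA ?fps_comp_coef0 ?z0 // gbB fps_id_comp ?z0.
(* Powers of z commute, and the factor c^(q p) produced by cz is cancelled by the coefficient. *)
have power_comp p q : (0 < p)%N -> (0 < q)%N ->
    fps_comp (fps_monomial 1 q) (fps_monomial 1 p) =
    fps_comp (fps_comp (fps_monomial (c ^+ (q * p))^-1 p) (fps_monomial 1 q))
      (fps_monomial c 1).
  move=> p_gt0 q_gt0; rewrite !fps_monomial_comp // !expr1n !mulr1 mul1n.
  by rewrite mulVf ?expf_neq0 // mulnC.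
pose d := (c ^+ (m ^ s * n ^ l))^-1.
have d_neq0 : d != 0 by rewrite invr_eq0 expf_neq0.
(* The exponents are crossed: X carries the power from B and Y the one from A, so both sides reduce
   to z^(m^s n^l) o gamma_A. *)
exists (fps_comp (fps_monomial 1 (m ^ s)) gamma_A).
exists (fps_comp (fps_monomial d (n ^ l)) gamma_B).
split.
- split; first by rewrite fps_comp_coef0 z0.
  apply: (monomial_neq0 _ beta_A 1 (m ^ s)%N); first exact: oner_neq0.
  by rewrite fps_compA // gbA fps_comp_id.
- split.
    by rewrite fps_comp_coef0 fps_monomial_coef0 // expn_gt0 ltnW.
  apply: (monomial_neq0 _ beta_B d (n ^ l)%N) => //.
  by rewrite fps_compA // gbB fps_comp_id.
rewrite !fps_compA // iterAV iterBV gBE -!fps_compA ?fps_comp_coef0 ?z0 //.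
by rewrite power_comp // expn_gt0 ltnW.
Qed.
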